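(* Consider the single stage pricing game with multiplicative loyalty described in the context, with parameters $c_A\ge c_B\ge 0$, $l_\alpha,l_\beta>0$, $\theta\in(0,1)$, and $F$ the distribution function of the uniform distribution on $[0,1]$. Suppose (Region III) $$c_A-c_B\le\min\{2l_\alpha,\,l_\beta\} .$$ Then the game has a unique pure Nash equilibrium, and its prices are $$p_A^\alpha=\tfrac13(2c_A+c_B+2l_\alpha),\quad p_A^\beta=\tfrac13(2c_A+c_B+l_\beta),\quad p_B^\beta=\tfrac13(2c_B+c_A+2l_\beta),\quad p_B^\alpha=\tfrac13(2c_B+c_A+l_\alpha) .$$
   Context: Two firms $A$ and $B$ sell the same product, with unit product costs $c_A$ and $c_B$, where $c_A\ge c_B\ge 0$. Customers are partitioned into a set $\alpha$ (ex ante loyal to $A$; a fraction $\theta$ of the market) and a set $\beta$ (ex ante loyal to $B$; a fraction $1-\theta$). Both firms can tell the two sets apart. Each customer buys exactly one unit, from $A$ or from $B$. Firms move simultaneously: $A$ chooses $(p_A^\alpha,p_A^\beta)$ with $p_A^\alpha,p_A^\beta\ge c_A$, and $B$ chooses $(p_B^\beta,p_B^\alpha)$ with $p_B^\beta,p_B^\alpha\ge c_B$; the superscript is the set of customers to which the price is offered. Multiplicative loyalty: a customer in $\alpha$ has loyalty level $l_\alpha\xi$ and buys from $A$ iff $l_\alpha\xi\ge p_A^\alpha-p_B^\alpha$; a customer in $\beta$ has loyalty level $l_\beta\xi$ and buys from $B$ iff $l_\beta\xi\ge p_B^\beta-p_A^\beta$; here $\xi$ is random with distribution function $F$. Put $\xi^\alpha=(p_A^\alpha-p_B^\alpha)/l_\alpha$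 and $\xi^\beta=(p_B^\beta-p_A^\beta)/l_\beta$. For the uniform distribution, $F(x)=0$ for $x\le 0$, $F(x)=x$ for $0\le x\le1$, $F(x)=1$ for $x\ge1$. Profits: firm $A$ gets $(p_A^\alpha-c_A)\,\theta\,(1-F(\xi^\alpha))+(p_A^\beta-c_A)(1-\theta)F(\xi^\beta)$; firm $B$ gets $(p_B^\beta-c_B)(1-\theta)(1-F(\xi^\beta))+(p_B^\alpha-c_B)\,\theta\,F(\xi^\alpha)$. A pure Nash equilibrium is a price profile $(p_A^\alpha,p_A^\beta,p_B^\beta,p_B^\alpha)$ from which neither firm can strictly increase its profit by unilaterally changing its own (feasible) prices. *)

(* Defs.v *)
From mathcomp Require Import all_boot all_order all_algebra.
From mathcomp Require Import reals.
Set Implicit Arguments.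
Unset Strict Implicit.
Unset Printing Implicit Defensive.
Import Order.TTheory GRing.Theory Num.Theory.
Local Open Scope ring_scope.

Definition uniform01_cdf (R : realType) (x : R) : R :=
  if x <= 0 then 0 else if x <= 1 then x else 1.

Record market (R : realType) := Market {
  cost_A : R;
  cost_B : R;
  loyalty_alpha : R;
  loyalty_beta : R;
  share_alpha : R  (* fraction of the customers that are ex ante loyal to A *)
}.

(* The prices one firm offers to each of the two sets of customers. *)
Record prices (R : realType) := Prices {
  to_alpha : R;
  to_beta : R
}.

Record profile (R : realType) := Profile {
  prices_A : prices R;
  prices_B : prices R
}.

Section Game.
Context {R : realType}.
Variables (F : R -> R) (m : market R).
Implicit Types a b : prices R.

(* A customer of alpha with loyalty factor xi buys from A iff
   xi >= xi_alpha a b; one of beta buys from B iff xi >= xi_beta a b. *)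
Definition xi_alpha a b : R := (to_alpha a - to_alpha b) / loyalty_alpha m.

Definition xi_beta a b : R := (to_beta b - to_beta a) / loyalty_beta m.

Definition profit_A a b : R :=
  (to_alpha a - cost_A m) * share_alpha m * (1 - F (xi_alpha a b))
  + (to_beta a - cost_A m) * (1 - share_alpha m) * F (xi_beta a b).

Definition profit_B a b : R :=
  (to_beta b - cost_B m) * (1 - share_alpha m) * (1 - F (xi_beta a b))
  + (to_alpha b - cost_B m) * share_alpha m * F (xi_alpha a b).

Definition feasible_A a : Prop :=
  cost_A m <= to_alpha a /\ cost_A m <= to_beta a.

Definition feasible_B b : Prop :=
  cost_B m <= to_alpha b /\ cost_B m <= to_beta b.

Definition pure_nash (s : profile R) : Prop :=
  [/\ feasible_A (prices_A s),
      feasible_B (prices_B s),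
      forall a, feasible_A a ->
        profit_A a (prices_B s) <= profit_A (prices_A s) (prices_B s)
    & forall b, feasible_B b ->
        profit_B (prices_A s) b <= profit_B (prices_A s) (prices_B s)].

End Game.

(* Main.v *)
(* Profits are additive over the two sets of customers and every price enters
   only one of the summands, so a profile is an equilibrium iff it is one in
   each of two independent duopolies.  In a duopoly both firms maximize the
   profit (p - c)(1 - F((p - r) / l)), where for the firm the customers are
   loyal to r is the rival's price, and for the other firm, since
   F(t) = 1 - F(1 - t), it is the rival's price minus l.  When r + l > c the
   unique maximizer is max(r, (c + r + l) / 2); when r + l <= c no sale is
   profitable and every p >= c is optimal.  The resulting piecewise linear
   system has a single solution in each duopoly. *)
Require Import Defs.
From mathcomp Require Import all_boot all_order all_algebra.
From mathcomp Require Import reals.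
From mathcomp Require Import ring lra.
Import Order.TTheory GRing.Theory Num.Theory.
Local Open Scope ring_scope.

Section Duopoly.
Context {R : realType}.
Implicit Types c d l p r x y t : R.

Let F := @uniform01_cdf R.

Definition loyal_profit l c r p := (p - c) * (1 - F ((p - r) / l)).

Definition best_price l c r p :=
  forall p', c <= p' -> loyal_profit l c r p' <= loyal_profit l c r p.

Lemma uniform01_cdf_sym t : F t = 1 - F (1 - t).
Proof.
rewrite /F /uniform01_cdf.
by case: (lerP t 0) => ?; case: (lerP t 1) => ?; case: (lerP (1 - t) 0) => ?;
   case: (lerP (1 - t) 1) => ?; lra.
Qed.

Lemma disloyal_profitE l d x y : 0 < l ->
  (y - d) * F ((x - y) / l) = loyal_profit l d (x - l) y.
Proof.
move=> l0; rewrite uniform01_cdf_sym /loyal_profit; congr (_ * (1 - F _)).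
by field; rewrite gt_eqF.
Qed.

(** Scaling by [l] clears the quotient inside [F] and leaves a piecewise polynomial in [p]. *)
Lemma loyal_profitE l c r p : 0 < l ->
  l * loyal_profit l c r p =
  (p - c) * (if p <= r then l else if p <= r + l then r + l - p else 0).
Proof.
move=> l0; rewrite /loyal_profit /F /uniform01_cdf mulrCA; congr (_ * _).
rewrite ler_pdivrMr // mul0r subr_le0 ler_pdivrMr // mul1r.
rewrite lerBlDl.
case: ifP => _; first by ring.
case: ifP => _; last by ring.
by field; rewrite gt_eqF.
Qed.

Lemma max_profitE l c r : 0 < l -> c < r + l ->
  l * loyal_profit l c r (Num.max r ((c + r + l) / 2)) =
  if r <= (c + r + l) / 2 then ((r + l - c) / 2) ^+ 2 else (r - c) * l.
Proof.
move=> l0 rc; rewrite loyal_profitE //.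
case: (lerP r ((c + r + l) / 2)) => rh; last by rewrite lexx.
case: lerP => hr; last by rewrite ifT; [field | lra].
have -> : l = r - c by lra.
by field.
Qed.

Lemma best_priceP l c r p : 0 < l -> c <= p ->
  best_price l c r p <-> r + l <= c \/ p = Num.max r ((c + r + l) / 2).
Proof.
move=> l0 cp; rewrite /best_price; case: (lerP (r + l) c) => rc.
  split=> [_|_ p' cp']; first by left.
  suff no_profit q : c <= q -> l * loyal_profit l c r q = 0.
    by rewrite -(ler_pM2l l0) !no_profit.
  move=> cq; rewrite loyal_profitE // ifF; last by lra.
  case: (lerP q (r + l)) => qr; last by rewrite mulr0.
  by have -> : r + l - q = 0; [lra | rewrite mulr0].
split=> [opt|[|->] p' cp']; last 1 first.
- rewrite -(ler_pM2l l0) max_profitE // loyal_profitE //.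
  case: (lerP r ((c + r + l) / 2)) => rh.
    case: (lerP p' r) => p'r.
      (* This square is the gap between the peak [((r + l - c) / 2) ^+ 2] of the parabola and its
         value [(r - c) * l] at price [r]. *)
      have := sqr_ge0 ((r + l - c) / 2 - (r - c)).
      have : (p' - c) * l <= (r - c) * l by rewrite ler_pM2r //; lra.
      by nra.
    case: (lerP p' (r + l)) => ?; last by rewrite mulr0 sqr_ge0.
    have := sqr_ge0 ((r + l - c) / 2 - (p' - c)).
    by nra.
  case: (lerP p' r) => p'r; first by rewrite ler_pM2r //; lra.
  case: (lerP p' (r + l)) => ?; last by rewrite mulr0 mulr_ge0 //; lra.
  (* The product is the scaled profit lost by raising the price from [r] to [p']; a midpoint below
     [r] means [l < r - c]. *)
  have : 0 <= (p' - r) * (p' - c - l) by rewrite mulr_ge0 //; lra.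
  by nra.
(* Optimality is tested only against [q]: the loss terms used above cannot be positive, which forces
   [p = q]. *)
- right; set q := Num.max _ _.
  have cq : c <= q by rewrite le_max; case: (lerP c r) => //= ?; lra.
  have := opt q cq; rewrite -(ler_pM2l l0) max_profitE // loyal_profitE // /q {cq q}.
  case: (lerP r ((c + r + l) / 2)) => rh.
    case: (lerP p r) => pr opt_p.
      have pl : (p - c) * l <= (r - c) * l by rewrite ler_pM2r //; lra.
      have : ((r + l - c) / 2 - (r - c)) ^+ 2 <= 0 by nra.
      rewrite real_exprn_even_le0 ?num_real //= => /eqP rE.
      have : (r - c) * l <= (p - c) * l by nra.
      by rewrite ler_pM2r // => ?; lra.
    have h0 : 0 < ((r + l - c) / 2) ^+ 2 by rewrite exprn_gt0 //; lra.
    move: opt_p; case: (lerP p (r + l)) => pl opt_p; last by lra.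
    have : ((r + l - c) / 2 - (p - c)) ^+ 2 <= 0 by nra.
    by rewrite real_exprn_even_le0 ?num_real //= => /eqP; lra.
  case: (lerP p r) => pr; first by rewrite ler_pM2r // => ?; lra.
  case: (lerP p (r + l)) => pl opt_p.
    have : 0 < (p - r) * (p - c - l) by rewrite mulr_gt0 //; lra.
    by nra.
  have : 0 < (r - c) * l by rewrite mulr_gt0 //; lra.
  by lra.
- by lra.
Qed.

(** The stated prices give [x - y = (c - d + l) / 3], so the two cost bounds say exactly that
    [(x - y) / l] lies in [0, 1], where [F] is linear. *)
Lemma duopoly_equilibriumP l c d x y :
    0 < l -> c - d <= 2 * l -> d - c <= l ->
  [/\ c <= x, d <= y, best_price l c y x & best_price l d (x - l) y] <->
  x = 1 / 3 * (2 * c + d + 2 * l) /\ y = 1 / 3 * (2 * d + c + l).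
Proof.
move=> l0 cd dc; split=> [[cx dy bx by_]|[xE yE]].
  move/(best_priceP _ _ _ _ l0 cx): bx; move/(best_priceP _ _ _ _ l0 dy): by_.
  (* A no-sale alternative survives only if a cost bound is an equality, and the prices are then
     still the stated ones. *)
  case: (lerP y ((c + y + l) / 2)) => ?;
    case: (lerP (x - l) ((d + (x - l) + l) / 2)) => ?;
    by move=> [] ? [] ?; lra.
have cx : c <= x by lra.
have dy : d <= y by lra.
split=> //; apply/best_priceP => //; right.
  by case: (lerP y ((c + y + l) / 2)) => ?; lra.
by case: (lerP (x - l) ((d + (x - l) + l) / 2)) => ?; lra.
Qed.

Variables (cA cB la lb theta : R).
Hypotheses (hla : 0 < la) (hlb : 0 < lb).
Hypotheses (htheta0 : 0 < theta) (htheta1 : theta < 1).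

Let m := Market cA cB la lb theta.

Lemma profit_AE (a b : prices R) : profit_A F m a b =
  theta * loyal_profit la cA (to_alpha b) (to_alpha a)
  + (1 - theta) * loyal_profit lb cA (to_beta b - lb) (to_beta a).
Proof.
rewrite -disloyal_profitE // /profit_A /xi_alpha /xi_beta /loyal_profit /=.
by ring.
Qed.

Lemma profit_BE (a b : prices R) : profit_B F m a b =
  (1 - theta) * loyal_profit lb cB (to_beta a) (to_beta b)
  + theta * loyal_profit la cB (to_alpha a - la) (to_alpha b).
Proof.
rewrite -disloyal_profitE // /profit_B /xi_alpha /xi_beta /loyal_profit /=.
by ring.
Qed.

Lemma pure_nashP (a b : prices R) : pure_nash F m (Profile a b) <->
  [/\ cA <= to_alpha a, cB <= to_alpha b,
      best_price la cA (to_alpha b) (to_alpha a)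
    & best_price la cB (to_alpha a - la) (to_alpha b)] /\
  [/\ cB <= to_beta b, cA <= to_beta a,
      best_price lb cB (to_beta a) (to_beta b)
    & best_price lb cA (to_beta b - lb) (to_beta a)].
Proof.
have theta1' : 0 < 1 - theta by rewrite subr_gt0.
split=> [[/= [Aa Ab] [Ba Bb] optA optB]|
         [[Aa Ba bAa bBa] [Bb Ab bBb bAb]]].
  (* Deviating in one price alone cancels the other summand; the positive weight then divides
     out. *)
  split; split=> // p hp.
  - have := optA (Prices p (to_beta a)) (conj hp Ab).
    by rewrite !profit_AE lerD2r ler_pM2l.
  - have := optB (Prices p (to_beta b)) (conj hp Bb).
    by rewrite !profit_BE lerD2l ler_pM2l.
  - have := optB (Prices (to_alpha b) p) (conj Ba hp).
    by rewrite !profit_BE lerD2r ler_pM2l.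
  - have := optA (Prices (to_alpha a) p) (conj Aa hp).
    by rewrite !profit_AE lerD2l ler_pM2l.
split=> //= p [pa pb]; rewrite ?profit_AE ?profit_BE.
  by rewrite lerD // ler_pM2l //; [apply: bAa | apply: bAb].
by rewrite lerD // ler_pM2l //; [apply: bBb | apply: bBa].
Qed.

End Duopoly.

Theorem proposition12 (R : realType) (cA cB la lb theta : R)
    (hcB : 0 <= cB) (hcA : cB <= cA)
    (hla : 0 < la) (hlb : 0 < lb)
    (htheta0 : 0 < theta) (htheta1 : theta < 1)
    (hIII : cA - cB <= Num.min (2 * la) lb) :
  exists s : profile R,
    unique (pure_nash (@uniform01_cdf R) (Market cA cB la lb theta)) s /\
    [/\ to_alpha (prices_A s) = 1 / 3 * (2 * cA + cB + 2 * la),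
        to_beta (prices_A s) = 1 / 3 * (2 * cA + cB + lb),
        to_beta (prices_B s) = 1 / 3 * (2 * cB + cA + 2 * lb)
      & to_alpha (prices_B s) = 1 / 3 * (2 * cB + cA + la)].
Proof.
move: hIII; rewrite le_min => /andP [hA hB].
(* In beta the loyal firm is B, so the two costs swap roles there. *)
have hA' : cB - cA <= la by lra.
have hB' : cB - cA <= 2 * lb by lra.
exists (Profile
  (Prices (1 / 3 * (2 * cA + cB + 2 * la)) (1 / 3 * (2 * cA + cB + lb)))
  (Prices (1 / 3 * (2 * cB + cA + la)) (1 / 3 * (2 * cB + cA + 2 * lb)))).
split=> //; split=> [|[[aa ab] [ba bb]]].
  by apply/pure_nashP => //; split; apply/duopoly_equilibriumP.
move=> /pure_nashP [] // /duopoly_equilibriumP [] //= -> ->.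
by move=> /duopoly_equilibriumP [] //= -> ->.
Qed.
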